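(* Let $G$ be a finite abelian group, $k\ge1$, and let $\varphi$ be an automorphism of finite order of the restricted wreath product $G\wr\mathbb{Z}^k=\Sigma\rtimes_\alpha\mathbb{Z}^k$. Let $\varphi'=\varphi|_\Sigma$. Then $R(\varphi')$ equals either $1$ or $\infty$.
   Context: Reidemeister number $R(\psi)$ of an endomorphism $\psi$ of a group $H$: the number of classes of $x\sim gx\psi(g^{-1})$, $g\in H$ (possibly $\infty$); for abelian $H$, $R(\psi)=|\mathrm{Coker}(\mathrm{Id}-\psi)|$. $\Sigma=\bigoplus_{x\in\mathbb{Z}^k}G_x$, each $G_x$ a copy of $G$, $\alpha(x)(g_y)=g_{x+y}$; $\Sigma$ is the torsion subset of $G\wr\mathbb{Z}^k$ and hence $\varphi$-invariant. *)

(* Defs.v *)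
From HB Require Import structures.
From mathcomp Require Import all_boot all_order all_algebra.
Set Implicit Arguments. Unset Strict Implicit. Unset Printing Implicit Defensive.
Import Order.TTheory GRing.Theory Num.Theory.
Local Open Scope ring_scope.

(* The lattice Z^k is 'rV[int]_k.  An element of the (unrestricted) function
   space G^(Z^k) is a function 'rV[int]_k -> G; Sigma = (+)_{x in Z^k} G_x is
   the set of finitely supported such functions.  The restricted wreath
   product G wr Z^k = Sigma x|_alpha Z^k is realised as the subset [inW] of
   pairs (sigma, z), with product
     (sigma, z) * (tau, w) = (sigma + alpha(z) tau, z + w),
   where (alpha(z) tau)(x) = tau (x - z), i.e. alpha(z)(g_y) = g_(z+y). *)

Definition carrier (G : zmodType) (k : nat) : Type :=
  (('rV[int]_k -> G) * 'rV[int]_k)%type.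

Definition fin_supp (G : zmodType) (k : nat) (f : 'rV[int]_k -> G) : Prop :=
  exists s : seq 'rV[int]_k, forall x, x \notin s -> f x = 0.

Definition inW (G : zmodType) (k : nat) (a : carrier G k) : Prop :=
  fin_supp a.1.

Definition inSigma (G : zmodType) (k : nat) (a : carrier G k) : Prop :=
  fin_supp a.1 /\ a.2 = 0.

Definition wmul (G : zmodType) (k : nat) (a b : carrier G k) : carrier G k :=
  (fun x => a.1 x + b.1 (x - a.2), a.2 + b.2).

Definition winv (G : zmodType) (k : nat) (a : carrier G k) : carrier G k :=
  (fun x => - a.1 (x + a.2), - a.2).

Definition is_fin_order_aut (G : zmodType) (k : nat)
    (phi : carrier G k -> carrier G k) : Prop :=
  [/\ (forall a, inW a -> inW (phi a)),
      (forall a b, inW a -> inW b -> phi (wmul a b) = wmul (phi a) (phi b)),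
      (forall a b, inW a -> inW b -> phi a = phi b -> a = b),
      (forall b, inW b -> exists a, inW a /\ phi a = b)
    & (exists n : nat, (0 < n)%N /\ forall a, inW a -> iter n phi a = a)].

Definition reid_rel (G : zmodType) (k : nat)
    (phi : carrier G k -> carrier G k) (x y : carrier G k) : Prop :=
  exists g, inSigma g /\ y = wmul (wmul g x) (winv (phi g)).

Definition num_classes_eq (T : Type) (A : T -> Prop) (r : T -> T -> Prop)
    (n : nat) : Prop :=
  exists f : 'I_n -> T,
    [/\ (forall i, A (f i)),
        (forall i j, r (f i) (f j) -> i = j)
      & (forall x, A x -> exists i, r x (f i))].

Definition reid_num_eq (G : zmodType) (k : nat)
    (phi : carrier G k -> carrier G k) (n : nat) : Prop :=
  num_classes_eq (@inSigma G k) (reid_rel phi) n.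

Definition reid_num_inf (G : zmodType) (k : nat)
    (phi : carrier G k -> carrier G k) : Prop :=
  ~ exists n, reid_num_eq phi n.

(* Main.v *)
(** Let psi be the restriction of phi to Sigma and D = Id - psi.  As G is finite
    and psi has finite order, the powers of D take finitely many values, so
    D^i = D^(i+N) for some i and some N > 0.  Suppose that coker D is finite.
    An element T of the group ring of <psi> with T D = 0 factors through
    coker D, so the functions T u have supports in one finite set; since psi
    intertwines translations by z and M z, with M injective, this forces T = 0.
    Applied to T = D^m - D^(m+N) for m = i-1, ..., 0 this gives D^N = Id, so D
    is onto and R(psi) = 1. *)

Require Import Defs.
From HB Require Import structures.
From mathcomp Require Import all_boot all_order all_algebra.
From mathcomp Require Import fingroup cyclic.
From Stdlib Require Import Classical FunctionalExtensionality.

Set Implicit Arguments.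
Unset Strict Implicit.
Unset Printing Implicit Defensive.
Import Order.TTheory GRing.Theory Num.Theory.

(** * Pigeonhole, sums over fibres and finite supports *)

Section Combinatorics.
Local Open Scope ring_scope.

Lemma iter_eq_of_fin (T : finType) (f : T -> T) (x : T) :
  exists i N, (0 < N)%N /\ iter i f x = iter (i + N) f x.
Proof.
pose h (i : 'I_(#|T|.+1)) := iter i f x.
have /injectivePn [i [j neq_ij eq_h]] : ~~ injectiveb h.
  by apply/injectiveP => /leq_card; rewrite card_ord ltnn.
have [lt_ij|lt_ji|/val_inj eq_ij] := ltngtP i j; last by rewrite eq_ij eqxx in neq_ij.
- by exists i, (j - i)%N; rewrite subn_gt0 subnKC // ltnW.
- by exists j, (i - j)%N; rewrite subn_gt0 subnKC // ltnW.
Qed.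

(** Group the terms by their value under [h]. Only attained values occur, so the partition runs over
    the finite codomain of [h] even when [X] is infinite. *)
Lemma sum_fibers_eq0 (V : nmodType) (X : choiceType) (I : finType)
    (h : I -> X) (F : I -> V) :
  (forall l, \sum_(i | h i == h l) F i = 0) -> \sum_i F i = 0.
Proof.
move=> F0; rewrite (partition_big (fun i => SeqSub (codom_f h i)) xpredT) //=.
apply: big1 => -[y y_h] _; have /codomP [l y_l] := y_h.
by rewrite -[RHS](F0 l) -y_l.
Qed.

(** In a coordinate [j] where [y] is nonzero, [x + y *+ m] can meet [b] only if m is at most |b_j -
    x_j|. *)
Lemma eventually_notin (k : nat) (s : seq 'rV[int]_k) (x y : 'rV[int]_k) :
  y != 0 -> exists m0, forall m, (m0 <= m)%N -> x + y *+ m \notin s.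
Proof.
case/rV0Pn => j yj; elim: s => [|b s [m0 IHs]]; first by exists 0%N.
exists (maxn m0 (absz (b 0 j - x 0 j)%R).+1) => m.
rewrite geq_max => /andP [/IHs xym lt_m].
rewrite inE negb_or xym andbT; apply/eqP => /(congr1 (fun v : 'rV_k => v 0 j)).
rewrite !mxE mulmxnE -mulr_natr => eqb; have : y 0 j * m%:R = b 0 j - x 0 j.
  by rewrite -eqb [RHS]addrC addKr.
move/(congr1 absz); rewrite abszM natz absz_nat => eqm; move: lt_m.
by rewrite -eqm ltnNge leq_pmull // absz_gt0.
Qed.

Lemma common_support (G : zmodType) (k : nat) (I : finType)
    (F : I -> 'rV[int]_k -> G) :
  (forall i, fin_supp (F i)) ->
  exists s : seq 'rV[int]_k, forall i x, x \notin s -> F i x = 0.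
Proof.
case/fin_all_exists => s sP; exists (flatten [seq s i | i <- enum I]) => i x xs.
apply: sP; apply: contra xs => xsi; apply/flatten_mapP.
by exists i => //; rewrite mem_enum.
Qed.

End Combinatorics.

(** * The group ring of a finite-order map that twists translations *)

Section TwistedAction.
Local Open Scope ring_scope.
Variables (G : finZmodType) (k : nat) (n : nat).
Local Notation X := 'rV[int]_k.
Local Notation Fn := (X -> G).
Variables (psi : Fn -> Fn) (M : X -> X).

Hypothesis psi_supp : forall u, fin_supp u -> fin_supp (psi u).
Hypothesis psiB : forall u v, fin_supp u -> fin_supp v ->
  psi (fun x => u x - v x) = (fun x => psi u x - psi v x).
Hypothesis psi_shift : forall z u, fin_supp u ->
  psi (fun x => u (x - z)) = (fun x => psi u (x - M z)).
Hypothesis psi_ord : forall u, fin_supp u -> iter n.+1 psi u = u.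
Hypothesis MD : {morph M : x y / x + y}.
Hypothesis M_ord : forall z, iter n.+1 M z = z.

Definition one_minus (u : Fn) : Fn := fun x => u x - psi u x.

Lemma fin_suppB (u v : Fn) :
  fin_supp u -> fin_supp v -> fin_supp (fun x => u x - v x).
Proof.
move=> [s us] [t vt]; exists (s ++ t) => x.
by rewrite mem_cat negb_or => /andP [xs xt]; rewrite us ?vt ?subr0.
Qed.

Lemma fin_supp_shift (z : X) (u : Fn) :
  fin_supp u -> fin_supp (fun x => u (x - z)).
Proof.
move=> [s us]; exists [seq x + z | x <- s] => x xs.
by apply: us; apply: contra xs => xs; apply/mapP; exists (x - z); rewrite ?subrK.
Qed.

Lemma one_minus_supp u : fin_supp u -> fin_supp (one_minus u).
Proof. by move=> su; apply: fin_suppB => //; apply: psi_supp. Qed.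

Lemma iter_one_minus_supp m u : fin_supp u -> fin_supp (iter m one_minus u).
Proof. by move=> su; elim: m => //= m; apply: one_minus_supp. Qed.

Lemma iter_psi_supp i u : fin_supp u -> fin_supp (iter i psi u).
Proof. by move=> su; elim: i => //= i; apply: psi_supp. Qed.

Lemma iter_psiB i u v : fin_supp u -> fin_supp v ->
  iter i psi (fun x => u x - v x) = (fun x => iter i psi u x - iter i psi v x).
Proof.
by move=> su sv; elim: i => //= i ->; rewrite psiB //; apply: iter_psi_supp.
Qed.

Lemma iter_psi_shift i z u : fin_supp u ->
  iter i psi (fun x => u (x - z)) = (fun x => iter i psi u (x - iter i M z)).
Proof.
by move=> su; elim: i => //= i ->; rewrite psi_shift //; apply: iter_psi_supp.
Qed.

Lemma M0 : M 0 = 0.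
Proof. by apply: (@addrI _ (M 0)); rewrite -MD !addr0. Qed.

Lemma iter_MMn i z m : iter i M (z *+ m) = iter i M z *+ m.
Proof.
elim: i => //= i ->; elim: m => [|m IHm]; first by rewrite !mulr0n M0.
by rewrite !mulrS MD IHm.
Qed.

(** Completing the cycle with the remaining [n.+1 - i] iterates recovers z. *)
Lemma iter_M_neq0 (i : 'I_n.+1) z : z != 0 -> iter i M z != 0.
Proof.
apply: contra => /eqP Mz0; rewrite -(M_ord z) -(subnK (ltnW (ltn_ord i))).
rewrite iterD Mz0; apply/eqP; elim: (_ - _)%N => //= m ->; exact: M0.
Qed.

(* The elements [\sum_i c_i psi^i] of the group ring of the cyclic group
   generated by psi; letting the coefficients be self-maps of the finite group
   G makes the set of coefficient families finite. *)
Definition op (c : {ffun 'I_n.+1 -> {ffun G -> G}}) (u : Fn) : Fn :=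
  fun x => \sum_i c i (iter i psi u x).

Definition additive_coefs (c : {ffun 'I_n.+1 -> {ffun G -> G}}) :=
  forall i g h, c i (g - h) = c i g - c i h.

(** Multiplication by Id - psi in the group ring: multiplying by psi shifts the coefficients
    cyclically, hence [ord_pred]. *)
Definition step (c : {ffun 'I_n.+1 -> {ffun G -> G}}) :
    {ffun 'I_n.+1 -> {ffun G -> G}} :=
  [ffun i => c i - c (ord_pred i)].

Definition coefs1 : {ffun 'I_n.+1 -> {ffun G -> G}} :=
  [ffun i => [ffun g => if i == ord0 then g else 0]].

Lemma coefs0 c i : additive_coefs c -> c i 0 = 0.
Proof. by move=> cB; rewrite -[X in c i X](subrr 0) cB subrr. Qed.

Lemma opB c u v : additive_coefs c -> fin_supp u -> fin_supp v ->
  forall x, op c (fun x => u x - v x) x = op c u x - op c v x.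
Proof.
move=> cB su sv x; rewrite /op -sumrB; apply: eq_bigr => i _.
by rewrite iter_psiB // cB.
Qed.

Lemma op_supp c u : additive_coefs c -> fin_supp u -> fin_supp (op c u).
Proof.
move=> cB su.
have [s sP] := common_support (fun i : 'I_n.+1 => iter_psi_supp i su).
by exists s => x xs; apply: big1 => i _; rewrite sP // coefs0.
Qed.

Lemma additive_coefsB c d :
  additive_coefs c -> additive_coefs d -> additive_coefs (c - d).
Proof. by move=> cB dB i g h; rewrite !ffunE cB dB !opprD !opprK addrACA. Qed.

Lemma additive_step c : additive_coefs c -> additive_coefs (step c).
Proof. by move=> cB i g h; rewrite !ffunE !cB !opprD !opprK addrACA. Qed.

Lemma additive_iter_step m : additive_coefs (iter m step coefs1).
Proof.
elim: m => [|m]; last exact: additive_step.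
by move=> i g h; rewrite !ffunE; case: ifP => // _; rewrite subr0.
Qed.

Lemma op_one_minus c u : additive_coefs c -> fin_supp u ->
  op c (one_minus u) = op (step c) u.
Proof.
move=> cB su; apply: functional_extensionality => x.
rewrite opB //; last exact: psi_supp.
rewrite {1 3}/op; under [RHS]eq_bigr do rewrite !ffunE.
rewrite sumrB; congr (_ - _).
rewrite [RHS](reindex_onto (@ordS _) (@ord_pred _)) /=; last first.
  by move=> i _; rewrite ord_predK.
apply: eq_big => [i|i _]; first by rewrite ordSK eqxx.
rewrite ordSK -iterSr /=; congr (c i (_ x)).
(* Only the wrap-around index [n] uses psi^(n+1) = Id. *)
have [->|ne_in] := eqVneq (i : nat) n; first by rewrite modnn /= -iterS psi_ord.
by rewrite modn_small // ltnS ltn_neqAle ne_in -ltnS ltn_ord.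
Qed.

(** Realises each power of Id - psi by a coefficient family, hence by a point of a finite set. *)
Lemma op_iter_step m u : fin_supp u ->
  op (iter m step coefs1) u = iter m one_minus u.
Proof.
elim: m u => [|m IHm] u su; last first.
  rewrite [RHS]iterSr -IHm ?op_one_minus //; first exact: additive_iter_step.
  exact: one_minus_supp.
apply: functional_extensionality => x.
rewrite /op big_ord_recl big1 => [|i _]; last by rewrite !ffunE.
by rewrite !ffunE /= addr0.
Qed.

(* Translating u by m z spreads the terms of [op c u] along the orbit of z:
   for m large the pieces with different directions [iter i M z] are disjoint
   and leave s, hence each of them vanishes, and so does their sum. *)
Lemma op_eq0_of_bounded_image c (s : seq X) : (0 < k)%N -> additive_coefs c ->
  (forall u x, fin_supp u -> x \notin s -> op c u x = 0) ->
  forall u x, fin_supp u -> op c u x = 0.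
Proof.
move=> k_gt0 cB opc u x su.
pose z : X := const_mx 1.
have z_neq0 : z != 0.
  by apply/eqP => /rowP /(_ (Ordinal k_gt0)); rewrite !mxE.
rewrite /op; apply: (sum_fibers_eq0 (h := fun i : 'I_n.+1 => iter i M z)) => l.
have [t tP] := common_support (fun i : 'I_n.+1 => iter_psi_supp i su).
(* With u translated by m z and [op c] evaluated at x + m M^l z, term [i] reads psi^i u at x + m (y
   i). This is x itself on the fibre of [l], and leaves [t] for large m elsewhere. *)
pose y (i : 'I_n.+1) := iter l M z - iter i M z.
have /fin_all_exists [m_ m_P] (i : 'I_n.+1) : exists m0, forall m,
    (m0 <= m)%N -> y i != 0 -> x + y i *+ m \notin t.
  have [y0|/(eventually_notin t x) [m0 m0P]] := eqVneq (y i) 0.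
    by exists 0%N.
  by exists m0 => m le_m _; apply: m0P.
have [m1 m1P] := eventually_notin s x (iter_M_neq0 l z_neq0).
pose m := maxn m1 (\max_i m_ i).
have := m1P m (leq_maxl _ _) => /(opc (fun x => u (x - z *+ m))) => /(_ _).
move=> /(_ (fin_supp_shift _ su)) E; rewrite -[RHS]E /op.
rewrite [RHS](bigID (fun i : 'I_n.+1 => iter i M z == iter l M z)) /=.
rewrite [X in _ + X]big1 ?addr0 => [|i ne_i].
  apply: eq_bigr => i /eqP eq_i.
  by rewrite iter_psi_shift // iter_MMn eq_i addrK.
rewrite iter_psi_shift // iter_MMn -addrA -mulrnBl tP ?coefs0 //.
apply: m_P; last by rewrite subr_eq0 eq_sym.
by apply: leq_trans (leq_maxr _ _); apply: leq_bigmax.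
Qed.

Lemma one_minus_surj_of_fin_coker (r : nat) (f : 'I_r -> Fn) : (0 < k)%N ->
  (forall i, fin_supp (f i)) ->
  (forall u, fin_supp u ->
     exists i g, fin_supp g /\ u = (fun x => f i x - one_minus g x)) ->
  forall u, fin_supp u -> exists g, fin_supp g /\ one_minus g = u.
Proof.
move=> k_gt0 sf f_repr.
(* If T D = 0, then T v equals T (f i) for some [i], so all images of T are supported in one finite
   set. *)
have coker_finite c : additive_coefs c ->
    (forall u, fin_supp u -> forall x, op c (one_minus u) x = 0) ->
    forall u, fin_supp u -> forall x, op c u x = 0.
  move=> cB c_im u su x.
  have [s sP] := common_support (fun i => op_supp cB (sf i)).
  apply: (op_eq0_of_bounded_image k_gt0 cB (s := s)) => // v y sv ys.
  have [i [g [sg ->]]] := f_repr v sv.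
  rewrite opB //; last exact: one_minus_supp.
  by rewrite c_im // subr0 sP.
(* The pigeonhole acts on coefficient families, so one pair (i, N) serves all functions u. *)
have [i [N [N_gt0 eq_iN]]] := iter_eq_of_fin step coefs1.
pose T m := iter m step coefs1 - iter (m + N) step coefs1.
have TB m : additive_coefs (T m).
  by apply: additive_coefsB; apply: additive_iter_step.
have opT m u x : fin_supp u ->
    op (T m) u x = iter m one_minus u x - iter (m + N) one_minus u x.
  move=> su; rewrite -!op_iter_step // /op -sumrB.
  by apply: eq_bigr => j _; rewrite !ffunE.
(* Descent from T_i = 0 to T_0 = Id - D^N: since T_j D = T_(j+1), vanishing passes from j+1 to j. *)
have T0 m : (m <= i)%N ->
    forall u, fin_supp u -> forall x, op (T (i - m)%N) u x = 0.
  elim: m => [|m IHm] lt_mi.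
    move=> u su x; rewrite /op big1 // => j _.
    by rewrite subn0 /T eq_iN subrr !ffunE.
  apply: coker_finite => // u su x.
  rewrite opT; last exact: one_minus_supp.
  rewrite -!iterSr -addSn -subSn // subSS -opT //.
  by apply: IHm => //; apply: ltnW.
(* As D^N = Id, the function D^(N-1) u is a preimage of u. *)
move=> u su; exists (iter N.-1 one_minus u).
split; first exact: iter_one_minus_supp.
rewrite -iterS prednK //; apply: functional_extensionality => x.
have := T0 i (leqnn i) u su x.
by rewrite subnn opT // add0n /= => /eqP; rewrite subr_eq0 => /eqP.
Qed.

End TwistedAction.

(** * Maps induced by the automorphism on Sigma and on the lattice *)

Section WreathAutomorphism.
Local Open Scope ring_scope.
Variables (G : finZmodType) (k : nat) (phi : carrier G k -> carrier G k).
Hypothesis hphi : is_fin_order_aut phi.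
Local Notation X := 'rV[int]_k.

Let zf : X -> G := fun=> 0.
Definition sigma_map (u : X -> G) : X -> G := (phi (u, 0)).1.
(** The map induced on the quotient by Sigma, computed on the representatives (0, z). *)
Definition lattice_map (z : X) : X := (phi (zf, z)).2.

Lemma phi_inW a : inW a -> inW (phi a).
Proof. by case: hphi => + _ _ _ _; apply. Qed.

Lemma phiM a b : inW a -> inW b -> phi (wmul a b) = wmul (phi a) (phi b).
Proof. by case: hphi => _ + _ _ _; apply. Qed.

Lemma zf_supp : fin_supp zf. Proof. by exists [::]. Qed.

Lemma wmul_sigma (u v : X -> G) :
  wmul (u, 0) (v, 0) = ((fun x => u x + v x), 0) :> carrier G k.
Proof.
congr pair; last exact: addr0.
by apply: functional_extensionality => x /=; rewrite subr0.
Qed.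

(** The image of the identity is idempotent: its lattice part cancels first, then its function part
    pointwise. *)
Lemma phi1 : phi (zf, 0) = (zf, 0).
Proof.
have : phi (zf, 0) = wmul (phi (zf, 0)) (phi (zf, 0)).
  rewrite -phiM; try exact: zf_supp.
  rewrite wmul_sigma; congr (phi (_, _)).
  by apply: functional_extensionality => x; rewrite addr0.
case: (phi _) => t w; rewrite /wmul /= => -[eqt eqw].
have w0 : w = 0 by apply: (@addrI _ w); rewrite addr0.
rewrite w0; congr pair; apply: functional_extensionality => x.
apply: (@addrI _ (t x)); rewrite addr0.
by rewrite [in RHS]eqt w0 subr0.
Qed.

(* Sigma is torsion while Z^k is torsion-free. *)
Lemma phi_sigma2 (u : X -> G) : fin_supp u -> (phi (u, 0)).2 = 0.
Proof.
move=> [s us].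
(* (m u, 0) is the m-th power of (u, 0); taking m = [#|G|] kills u. *)
have mulP m : inW (((fun x => u x *+ m), 0) : carrier G k) /\
    (phi ((fun x => u x *+ m), 0)).2 = (phi (u, 0)).2 *+ m.
  elim: m => [|m [IHs IHm]].
    by split; [exists [::] | rewrite (phi1 : phi ((fun=> 0), 0) = _) mulr0n].
  split; first by exists s => x xs /=; rewrite us // mul0rn.
  have -> : ((fun x => u x *+ m.+1), 0) = wmul (u, 0) ((fun x => u x *+ m), 0)
      :> carrier G k.
    rewrite wmul_sigma; congr pair.
    by apply: functional_extensionality => x; rewrite mulrS.
  by rewrite phiM //= ?IHm ?mulrS //; exists s.
have [_] := mulP #|G|.
have -> : (fun x => u x *+ #|G|) = zf.
  apply: functional_extensionality => x.
  by rewrite -FinRing.zmodXgE -cardsT (@expg_cardG _ [set: G]%G) ?inE.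
rewrite phi1 /= => eq0; apply/rowP => j; move/rowP/(_ j): eq0.
rewrite mulmxnE !mxE => /esym/eqP; rewrite mulrn_eq0.
have /card_gt0P/lt0n_neq0/negPf -> : exists g : G, g \in G by exists 0.
by move=> /eqP.
Qed.

Lemma phi_sigmaE (u : X -> G) : fin_supp u -> phi (u, 0) = (sigma_map u, 0).
Proof. by move=> su; rewrite [LHS]surjective_pairing phi_sigma2. Qed.

Lemma sigma_map_supp u : fin_supp u -> fin_supp (sigma_map u).
Proof. by move=> su; apply: phi_inW. Qed.

Lemma sigma_mapB u v : fin_supp u -> fin_supp v ->
  sigma_map (fun x => u x - v x) = (fun x => sigma_map u x - sigma_map v x).
Proof.
move=> su sv; have suv := fin_suppB su sv.
apply: functional_extensionality => x; apply/eqP; rewrite eq_sym subr_eq eq_sym.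
have /(congr1 (fun a : carrier G k => a.1 x)) := @phiM (_, 0) (_, 0) suv sv.
rewrite !phi_sigmaE // !wmul_sigma /= => <-; rewrite /sigma_map.
apply/eqP; congr ((phi (_, _)).1 x).
by apply: functional_extensionality => y; rewrite subrK.
Qed.

(** Apply [phi] to (0, z) (u, 0) = (alpha(z) u, 0) (0, z); the function part of phi(0, z) appears on
    both sides and cancels, as G is abelian. *)
Lemma sigma_map_shift z u : fin_supp u ->
  sigma_map (fun x => u (x - z)) = (fun x => sigma_map u (x - lattice_map z)).
Proof.
move=> su; have suz := fin_supp_shift z su.
have eqW : wmul (zf, z) (u, 0) = wmul ((fun x => u (x - z)), 0) (zf, z)
    :> carrier G k.
  congr pair => /=; last by rewrite addr0 add0r.
  by apply: functional_extensionality => x; rewrite addr0 add0r.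
have /(congr1 fst) := congr1 phi eqW.
rewrite !phiM //; try exact: zf_supp.
rewrite !phi_sigmaE // => /= eqf.
apply: functional_extensionality => x; have := congr1 (@^~ x) eqf => /=.
by rewrite subr0 addrC => /addIr.
Qed.

Lemma phi_snd a : inW a -> (phi a).2 = lattice_map a.2.
Proof.
case: a => u z su.
have -> : (u, z) = wmul (u, 0) (zf, z) :> carrier G k.
  congr pair => /=; last by rewrite add0r.
  by apply: functional_extensionality => x; rewrite addr0.
rewrite phiM //; try exact: zf_supp.
by rewrite phi_sigmaE //= !add0r.
Qed.

Lemma lattice_mapD : {morph lattice_map : x y / x + y}.
Proof.
move=> x y; rewrite -[RHS]/((wmul (phi (zf, x)) (phi (zf, y))).2) -phiM;
  try exact: zf_supp.
rewrite phi_snd //; exists [::] => t _ /=; exact: addr0.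
Qed.

Lemma iter_phi_inW m a : inW a -> inW (iter m phi a).
Proof. by move=> sa; elim: m => //= m; apply: phi_inW. Qed.

Lemma iter_phi_snd m a : inW a -> (iter m phi a).2 = iter m lattice_map a.2.
Proof.
by move=> sa; elim: m => //= m <-; rewrite phi_snd //; apply: iter_phi_inW.
Qed.

Lemma iter_phi_sigma m u : fin_supp u ->
  iter m phi (u, 0) = (iter m sigma_map u, 0).
Proof.
move=> su; elim: m => //= m ->; rewrite phi_sigmaE //.
by elim: m => //= m; apply: sigma_map_supp.
Qed.

Lemma reid_num_eq1_of_fin r : (0 < k)%N -> reid_num_eq phi r ->
  reid_num_eq phi 1.
Proof.
move=> k_gt0 [f [fS _ f_repr]].
have [n ord_n] : exists n, forall a, inW a -> iter n.+1 phi a = a.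
  by case: hphi => _ _ _ _ [[|n] [//]]; exists n.
(* On the abelian group Sigma the classes are the cosets of the image of Id - psi. *)
have rel_sigma u v g : fin_supp g ->
    ((v, 0) = wmul (wmul (g, 0) (u, 0)) (winv (phi (g, 0))) :> carrier G k) <->
    v = (fun x => u x + one_minus sigma_map g x).
  move=> sg; rewrite phi_sigmaE // /winv /= oppr0.
  set h := fun x => - _; have -> : h = (fun x => - sigma_map g x).
    by apply: functional_extensionality => x; rewrite /h addr0.
  rewrite !wmul_sigma; set w := fun x => _ + - _.
  have -> : w = (fun x => u x + one_minus sigma_map g x).
    by apply: functional_extensionality => x; rewrite /w addrAC addrC addrA.
  by split => [[]|->].
have surj := @one_minus_surj_of_fin_coker G k n sigma_map lattice_map
  sigma_map_supp sigma_mapB sigma_map_shift _ lattice_mapD _ r (fun i => (f i).1).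
have {}surj u : fin_supp u -> exists g, fin_supp g /\ one_minus sigma_map g = u.
  apply: surj => //.
  - by move=> v sv; have [] := congr1 fst (ord_n (v, 0) sv); rewrite iter_phi_sigma.
  - move=> z; have /(congr1 snd) := ord_n (zf, z) zf_supp.
    by rewrite iter_phi_snd //; exact: zf_supp.
  - by move=> i; case: (fS i).
  - move=> v sv; have [i [[g g0] [[/= sg ->] eq_fi]]] := f_repr (v, 0) (conj sv erefl).
    exists i, g; split => //; have [_ fi0] := fS i.
    rewrite (surjective_pairing (f i)) fi0 in eq_fi.
    have /(rel_sigma v (f i).1 g sg) -> := eq_fi.
    by apply: functional_extensionality => x; rewrite addrK.
exists (fun=> (zf, 0)); split=> [i|i j _|[u u2] [/= su ->]].
- by split => //; exact: zf_supp.
- by rewrite !ord1.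
(* Moving u to the representative 0 means solving (Id - psi) g = -u. *)
exists ord0; have /surj [g [sg eq_g]] : fin_supp (fun x => - u x).
  by case: su => s us; exists s => x /us ->; rewrite oppr0.
exists (g, 0); split => //; apply/rel_sigma => //.
by rewrite eq_g; apply: functional_extensionality => x; rewrite subrr.
Qed.

End WreathAutomorphism.

Theorem mainTheorem5 (G : finZmodType) (k : nat) (hk : (0 < k)%N)
    (phi : carrier G k -> carrier G k) (hphi : is_fin_order_aut phi) :
  reid_num_eq phi 1 \/ reid_num_inf phi.
Proof.
have [[r r_eq]|] := classic (exists r, reid_num_eq phi r); last by right.
by left; apply: reid_num_eq1_of_fin r_eq.
Qed.
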